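(* Let $(X,\operatorname{dist})$ be a compact metric space and let $f\colon X\to X$ be a homeomorphism. Then $f$ is hyper-expansive if and only if $f$ has a finite number of orbits and $\Omega(f)=\mathrm{Per}_r\cup\mathrm{Per}_a$.
   Context: Hyperspace: $2^X$ denotes the set of all nonempty compact subsets of $X$, with the Hausdorff metric $\operatorname{dist}_H(A,B)=\inf\{\epsilon>0: A\subset B_\epsilon(B)\text{ and }B\subset B_\epsilon(A)\}$, where $B_\epsilon(x)=\{y\in X:\operatorname{dist}(x,y)<\epsilon\}$ and $B_\epsilon(A)=\bigcup_{x\in A}B_\epsilon(x)$. Hyper-expansive: a homeomorphism $f\colon X\to X$ is hyper-expansive if there is $\delta>0$ such that whenever $A,B\in 2^X$ satisfy $\operatorname{dist}_H(f^n(A),f^n(B))<\delta$ for all $n\in\mathbb{Z}$, then $A=B$. The orbit of $x\in X$ is $\{f^n(x):n\in\mathbb{Z}\}$. Non-wandering set: $\Omega(f)$ is the set of $x\in X$ such that for all $\epsilon>0$ there is $n>0$ with $f^n(B_\epsilon(x))\cap B_\epsilon(x)\neq\emptyset$. Stability: a point $p\in X$ is (Lyapunov) stable if for all $\epsilon>0$ there is $\delta>0$ such that $\operatorname{dist}(x,p)<\delta$ implies $\operatorname{dist}(f^n(x),f^n(p))<\epsilon$ for all $n\ge 0$. It is asymptotically stable if it is stable and there is $\gamma>0$ such that $\operatorname{dist}(x,p)<\gamma$ implies $\operatorname{dist}(f^n(x),f^n(p))\to 0$ as $n\to\infty$. A periodic point $p$ is attracting (its orbit is an attractor) if $p$ is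 asymptotically stable for $f$; it is a repeller (its orbit is a repeller) if $p$ is asymptotically stable for $f^{-1}$. $\mathrm{Per}_a$ is the set of attracting periodic points of $f$ and $\mathrm{Per}_r$ is the set of repeller periodic points of $f$. These are not mutually exclusive: an isolated periodic point (one that is an isolated point of $X$) belongs to both. *)

(* Defs.v *)
From mathcomp Require Import all_boot all_order all_algebra.
From mathcomp Require Import all_classical all_reals all_analysis.

Set Implicit Arguments.
Unset Strict Implicit.
Unset Printing Implicit Defensive.

Import Order.TTheory GRing.Theory Num.Theory.
Import numFieldTopology.Exports numFieldNormedType.Exports.

Local Open Scope classical_set_scope.
Local Open Scope ring_scope.

(* The inverse map is carried along (it is determined by the function), so that
   negative iterates and stability for the inverse can be written directly. *)
Record homeomorphism (X : topologicalType) := Homeomorphism {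
  homeo_fun :> X -> X;
  homeo_inv : X -> X;
  homeo_funK : cancel homeo_fun homeo_inv;
  homeo_invK : cancel homeo_inv homeo_fun;
  homeo_fun_continuous : continuous homeo_fun;
  homeo_inv_continuous : continuous homeo_inv
}.

(* [Negz k] is the integer [- k.+1]. *)
Definition iterz (X : topologicalType) (f : homeomorphism X) (n : int) : X -> X :=
  match n with
  | Posz k => iter k f
  | Negz k => iter k.+1 (homeo_inv f)
  end.

Definition orbitz (X : topologicalType) (f : homeomorphism X) (x : X) : set X :=
  [set iterz f n x | n in [set: int]].

Definition finitely_many_orbits (X : topologicalType) (f : homeomorphism X) :=
  finite_set [set orbitz f x | x in [set: X]].

Section Dynamics.
Context {R : realType} {X : metricType R}.

Definition hyperspace : set (set X) := [set A | A !=set0 /\ compact A].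

Definition ball_set (A : set X) (e : R) : set X := \bigcup_(x in A) ball x e.

(* For nonempty compact arguments the set of admissible [e] is nonempty and
   bounded below by 0, so [inf] is the genuine infimum. *)
Definition hausdorff_dist (A B : set X) : R :=
  inf [set e : R | [/\ 0 < e, A `<=` ball_set B e & B `<=` ball_set A e]].

Definition hyper_expansive (f : homeomorphism X) : Prop :=
  exists2 delta : R, 0 < delta &
    forall A B : set X, hyperspace A -> hyperspace B ->
      (forall n : int,
         hausdorff_dist (iterz f n @` A) (iterz f n @` B) < delta) ->
      A = B.

Definition nonwandering (f : X -> X) : set X :=
  [set x | forall e : R, 0 < e -> exists2 n : nat, (0 < n)%N &
             (iter n f @` ball x e) `&` ball x e !=set0].

Definition stable (f : X -> X) (p : X) : Prop :=
  forall e : R, 0 < e -> exists2 d : R, 0 < d &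
    forall x : X, mdist x p < d ->
      forall n : nat, mdist (iter n f x) (iter n f p) < e.

Definition asymptotically_stable (f : X -> X) (p : X) : Prop :=
  stable f p /\
  exists2 g : R, 0 < g &
    forall x : X, mdist x p < g ->
      mdist (iter n f x) (iter n f p) @[n --> \oo] --> (0 : R).

Definition periodic (f : X -> X) (p : X) : Prop :=
  exists2 n : nat, (0 < n)%N & iter n f p = p.

Definition Per_a (f : homeomorphism X) : set X :=
  [set p | periodic f p /\ asymptotically_stable f p].

Definition Per_r (f : homeomorphism X) : set X :=
  [set p | periodic f p /\ asymptotically_stable (homeo_inv f) p].

End Dynamics.

(* Main.v *)
Require Import Defs.
From mathcomp Require Import all_boot all_order all_algebra.
From mathcomp Require Import all_classical all_reals all_analysis.
From mathcomp Require Import zify lra.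

Set Implicit Arguments.
Unset Strict Implicit.
Unset Printing Implicit Defensive.

Import Order.TTheory GRing.Theory Num.Theory.

Local Open Scope classical_set_scope.
Local Open Scope ring_scope.

(** Everything rests on a reformulation with single points instead of compact
    sets ([hyper_expansive_growth]): [f] is hyper-expansive iff, for some
    [dl > 0] and every point [x], each ball around [x], however small, has an
    iterate under some [f^n] that contains the ball of radius [dl] around
    [f^n x]. Indeed a compact set [B] missing [x] is contained in the
    complement of a ball around [x], and the distance between the iterates of
    [x |` B] and those of [B] is governed by how close [f^n x] is to
    [f^n B].

    Suppose that balls grow in this sense.

    - Cover [X] by finitely many balls of radius [dl / 2] and intersect them
      with an invariant set [Y]. Every ball around a point of [Y] contains an
      iterate of one of these traces. Say that one trace is below another
      when some iterate of the first lies in the second, and take a minimal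
      trace: each of its points has arbitrarily close iterates of the whole
      trace, staying inside the trace. Two disjoint such iterates cannot
      exist because powers of [f] commute, so the minimal trace is a single
      point, and [Y] has an isolated point ([isolated_point_of_growth]).

    - Applied to the closure of the orbit of [x], this isolates [x] in that
      closure. So an orbit is determined by its closure, and the closure is
      determined by which balls of a finite cover the orbit meets: there are
      finitely many orbits ([finitely_many_orbits_of_growth]).

    - An aperiodic [x] is isolated in [X]
      ([aperiodic_isolated_of_growth]), hence wandering. If it were not, every
      [f^n x] would have some point within [dl]: another point of the orbit
      for all but finitely many [n], and for the exceptional [n] the iterate
      of some point [w_n <> x]. A ball around [x] that avoids the rest of the
      orbit and the finitely many [w_n] would then never grow.

    - At a periodic point [p] there cannot be both a point [z <> p] whose
      past stays close to that of [p] and a point [w <> p] whose future does: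
      a ball around [p] avoiding [z] and [w] would not grow. If there is no
      such [z], a compactness argument makes [p] asymptotically stable; if
      there is no such [w], the same holds for the inverse
      ([periodic_attracting_or_repelling]).

    Conversely, with finitely many orbits a wandering point has a
    neighbourhood meeting each orbit at most once, which is therefore finite,
    so the point is isolated and its balls have already grown at time [0].
    The basin of an attracting periodic point is contracted uniformly, by
    compactness, so balls around the point grow backwards; dually for
    repelling points. The growth radius is constant along orbits, so finitely
    many orbits provide a common one. *)

(** * Integer iterates *)

Section Iterates.
Context {X : topologicalType}.
Implicit Types (f : homeomorphism X) (m n : int) (x y : X).

Definition inverse_homeo f : homeomorphism X :=
  Homeomorphism (homeo_invK f) (homeo_funK f)
    (@homeo_inv_continuous _ f) (@homeo_fun_continuous _ f).

Lemma iterzS f n x : iterz f (n + 1) x = f (iterz f n x).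
Proof.
case: n => [k|[|k]].
- by have -> : Posz k + 1 = Posz k.+1 by lia.
- by rewrite /= homeo_invK.
- have -> : Negz k.+1 + 1 = Negz k by lia.
  by rewrite [in RHS]/= homeo_invK.
Qed.

Lemma iterzD f m n x : iterz f (m + n) x = iterz f m (iterz f n x).
Proof.
elim/int_rec: m => [|k IH|k IH].
- by rewrite add0r.
- have -> : k.+1%:Z + n = (k%:Z + n) + 1 by lia.
  by rewrite iterzS IH.
- apply: (can_inj (homeo_funK f)); rewrite -!iterzS.
  have -> : - k.+1%:Z + n + 1 = - k%:Z + n by lia.
  by have -> : - k.+1%:Z + 1 = - k%:Z by lia.
Qed.

Lemma iterzK f n : cancel (iterz f n) (iterz f (- n)).
Proof. by move=> x; rewrite -iterzD addNr. Qed.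

Lemma iterzNK f n : cancel (iterz f (- n)) (iterz f n).
Proof. by move=> x; rewrite -iterzD addrN. Qed.

Lemma iterz_inverse f n x : iterz (inverse_homeo f) n x = iterz f (- n) x.
Proof. by case: n => [[|k]|k]. Qed.

Lemma iterz_continuous f n : continuous (iterz f n).
Proof.
have iter_cts (g : X -> X) k : continuous g -> continuous (iter k g).
  move=> gc; elim: k => [|k IH] x; first exact: cvg_id.
  exact: (@continuous_comp _ _ _ (iter k g) g x (IH x) (gc _)).
by case: n => k; apply: iter_cts;
  [exact: homeo_fun_continuous|exact: homeo_inv_continuous].
Qed.

Lemma iterz_period f (q k : nat) x :
  iter q f x = x -> iterz f (q * k)%N x = x.
Proof.
move=> qx; elim: k => [|k IH]; first by rewrite muln0.
by rewrite mulnS PoszD iterzD IH.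
Qed.

Lemma iterzN_period f (q k : nat) x :
  iter q f x = x -> iterz f (- (q * k)%N%:Z) x = x.
Proof. by move=> qx; rewrite -[in LHS](iterz_period k qx) iterzK. Qed.

Lemma orbitz_iter f n x : orbitz f (iterz f n x) = orbitz f x.
Proof.
apply/seteqP; split=> _ [m _ <-].
  by exists (m + n) => //; rewrite iterzD.
by exists (m - n) => //; rewrite -iterzD subrK.
Qed.

End Iterates.

(** * Finiteness lemmas *)

Lemma finite_uniform_radius (R : realFieldType) (I : choiceType) (S : set I)
    (P : I -> R -> Prop) :
  finite_set S -> (forall i a b, b <= a -> P i a -> P i b) ->
  (forall i, S i -> exists2 r, 0 < r & P i r) ->
  exists2 r, 0 < r & forall i, S i -> P i r.
Proof.
move=> /finite_seqP[s ->] Pmono; elim: s => [|i s IH] SP.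
  by exists 1.
have [j js|r r0 rP] := IH; first by apply: SP; rewrite /= inE js orbT.
have [|a a0 aP] := SP i; first by rewrite /= inE eqxx.
exists (Num.min r a); first by rewrite lt_min r0.
move=> j /=; rewrite inE => /orP[/eqP->|js].
  by apply: Pmono aP; rewrite ge_min lexx orbT.
by apply: Pmono (rP j js); rewrite ge_min lexx.
Qed.

Lemma finite_preorder_min (T : eqType) (le : T -> T -> Prop) (P : T -> Prop)
    (s : seq T) :
  (forall a, le a a) -> (forall b a c, le a b -> le b c -> le a c) ->
  (exists2 a, a \in s & P a) ->
  exists a, [/\ a \in s, P a &
    forall b, b \in s -> P b -> le b a -> le a b].
Proof.
move=> lexx letr; elim: s => [|c s IH] [a]; first by [].
have [[m ms Pm] _ _|noP] := pselect (exists2 m, m \in s & P m).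
  have [|{}m [{}ms {}Pm mmin]] := IH; first by exists m.
  have [[Pc cm]|ncm] := pselect (P c /\ le c m).
    exists c; split=> //; first by rewrite inE eqxx.
    move=> b; rewrite inE => /orP[/eqP->//|bs] Pb bc.
    exact: letr cm (mmin b bs Pb (letr _ _ _ bc cm)).
  exists m; split=> //; first by rewrite inE ms orbT.
  move=> b; rewrite inE => /orP[/eqP->|]; last exact: mmin.
  by move=> Pc cm; case: ncm.
rewrite inE => /orP[/eqP->|as_] Pa; last by case: noP; exists a.
exists c; split=> //; first by rewrite inE eqxx.
move=> b; rewrite inE => /orP[/eqP->//|bs] Pb.
by case: noP; exists b.
Qed.

Lemma finite_image_factor (T U : Type) (F : finType) (g : T -> F) (h : T -> U) :
  (forall x y, g x = g y -> h x = h y) -> finite_set [set h x | x in [set: T]].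
Proof.
move=> gh; apply: (@sub_finite_set _ _ (\bigcup_(c in [set: F])
    [set h x | x in [set x | g x = c]])).
  by move=> _ [x _ <-]; exists (g x) => //; exists x.
apply: bigcup_finite => [|c _]; first exact: finite_finset.
have [[x gx]|nc] := pselect (exists x, g x = c).
  apply: sub_finite_set (finite_set1 (h x)) => _ [y /= gy <-].
  by apply: gh; rewrite gx.
by apply: sub_finite_set (finite_set0 U) => _ [y /= gy _]; apply: nc; exists y.
Qed.

(** * Metric preliminaries and growth of balls *)

Section Metric.
Context {R : realType} {X : metricType R}.
Implicit Types (f : homeomorphism X) (m n : int) (x y p : X).

Lemma periodic_inverse f x :
  Defs.periodic (homeo_inv f) x <-> Defs.periodic f x.
Proof.
have fwd (g : homeomorphism X) :
    Defs.periodic g x -> Defs.periodic (homeo_inv g) x.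
  case=> q q0 qx; exists q => //.
  have := iterz_inverse g (Posz q) x; rewrite /= => ->.
  by have := iterzN_period 1 qx; rewrite muln1.
by split=> [/(fwd (inverse_homeo f))|/fwd].
Qed.

Lemma iterz_aperiodic f x n :
  ~ Defs.periodic f x -> iterz f n x = x -> n = 0.
Proof.
move=> npx nx; have [//|n0] := eqVneq n 0; case: npx.
exists `|n|%N; first by rewrite absz_gt0.
rewrite -[LHS]/(iterz f `|n|%N x).
have [n_ge0|n_le0] := leP 0 n; first by rewrite gez0_abs.
by rewrite ltz0_abs // -[in LHS]nx iterzK.
Qed.

Lemma nbhs_distP x (A : set X) :
  nbhs x A <-> exists2 r, 0 < r & forall y, mdist x y < r -> A y.
Proof.
split=> [/nbhs_ballP[r /= r0 rA]|[r r0 rA]].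
  by exists r => // y xy; apply: rA; rewrite ballEmdist.
by apply/nbhs_ballP; exists r => // y; rewrite ballEmdist => /rA.
Qed.

Lemma iterz_near f n x e : 0 < e ->
  exists2 r, 0 < r & forall y, mdist x y < r ->
    mdist (iterz f n x) (iterz f n y) < e.
Proof.
move=> e0.
apply: (nbhs_distP x [set y | mdist (iterz f n x) (iterz f n y) < e]).1.
apply: (@iterz_continuous _ f n x [set z | mdist (iterz f n x) z < e]).
by apply/nbhs_distP; exists e.
Qed.

(** The covering is indexed by the finite sequences of centres, directed by
    inclusion: near each point it suffices that the sequence contains that
    point. *)
Lemma compact_net (e : R) : compact [set: X] -> 0 < e ->
  exists s : seq X, forall x, exists2 c, c \in s & mdist c x < e.
Proof.
move=> /compact_near_coveringP cX e0.
pose F := filter_from [set: seq X] (fun s => [set t : seq X | {subset s <= t}]).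
have FF : Filter F.
  apply: filter_from_filter; first by exists [::].
  move=> s t _ _; exists (s ++ t) => // u stu.
  by split=> x xs; apply: stu; rewrite mem_cat xs ?orbT.
have [|s _ sP] := cX _ F (fun s x => exists2 c, c \in s & mdist c x < e) FF.
  move=> x _.
  exists ([set y | mdist x y < e], [set s | x \in s]) => /=.
    split; first by apply/nbhs_distP; exists e.
    by exists [:: x] => // t; apply; rewrite inE.
  by move=> [y s] /= [xy xs]; exists x.
by exists s => x; apply: (sP s).
Qed.

Lemma compact_increasing_cover (U : nat -> set X) :
  compact [set: X] -> (forall k l, (k <= l)%N -> U k `<=` U l) ->
  (forall x, exists k, exists2 r, 0 < r & forall y, mdist x y < r -> U k y) ->
  exists k, forall x, U k x.
Proof.
move=> /compact_near_coveringP cX Umono Uloc.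
have [|k _ kP] := cX _ \oo U _.
  move=> x _; have [k kx] := Uloc x.
  exists (U k, [set l | (k <= l)%N]) => /=.
    by split; [exact/nbhs_distP|exists k].
  by move=> [y l] /= [ky kl]; exact: Umono kl _ ky.
by exists k => x; apply: (kP k) => /=.
Qed.

(** Equivalently, the [n]-th iterate of the ball of radius [r] around [x]
    contains the ball of radius [dl] around [f^n x]. *)
Definition ball_growth f (dl : R) x := forall r : R, 0 < r ->
  exists n, forall y, mdist (iterz f n x) (iterz f n y) < dl -> mdist x y < r.

Lemma ball_growthS f a b x : b <= a -> ball_growth f a x -> ball_growth f b x.
Proof.
move=> ba G r /G[n nP]; exists n => y nb.
exact/nP/(lt_le_trans nb).
Qed.

Lemma ball_growth_iter f dl n x :
  ball_growth f dl x -> ball_growth f dl (iterz f n x).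
Proof.
move=> G r r0; have [a a0 aP] := iterz_near f n x r0.
have [k kP] := G a a0; exists (k - n) => y.
rewrite -iterzD subrK iterzD => /kP/aP.
by rewrite iterzNK.
Qed.

Lemma ball_growth_inverse f dl x :
  ball_growth (inverse_homeo f) dl x -> ball_growth f dl x.
Proof.
move=> G r /G[n nP]; exists (- n) => y.
by rewrite -!iterz_inverse => /nP.
Qed.

Lemma closed_far x (r : R) : closed [set y | r <= mdist x y].
Proof.
have -> : [set y | r <= mdist x y] = ~` [set y | mdist x y < r].
  by apply/seteqP; split=> y /=; rewrite leNgt => /negP.
apply: open_closedC; rewrite openE => y /= xy.
apply/nbhs_distP; exists (r - mdist x y) => [|z yz /=].
  by rewrite subr_gt0.
by apply: le_lt_trans (metric_triangle x y z) _; rewrite -ltrBrDl.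
Qed.

Lemma hausdorff_dist_le (A B : set X) (e : R) : 0 < e ->
  A `<=` ball_set B e -> B `<=` ball_set A e -> hausdorff_dist A B <= e.
Proof.
move=> e0 AB BA; apply: ge_inf; last by split.
by exists 0 => r [/ltW].
Qed.

(** Compactness bounds the distances to a point of [A] and to a point of [B],
    so that the infimum defining the distance is over a nonempty set. *)
Lemma hausdorff_dist_lt (A B : set X) (e : R) : A !=set0 -> B !=set0 ->
  compact [set: X] -> hausdorff_dist A B < e ->
  exists2 r, r < e & A `<=` ball_set B r /\ B `<=` ball_set A r.
Proof.
move=> [a Aa] [b Bb] cX AB.
have bnd z : exists k : nat, forall x, mdist z x < k%:R.
  apply: compact_increasing_cover => // [k l kl x /lt_le_trans|x].
    by apply; rewrite ler_nat.
  exists (Num.truncn (mdist z x + 1)).+1, 1 => // y xy.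
  apply: le_lt_trans (metric_triangle z x y) _.
  by apply: lt_trans (truncnS_gt _); rewrite ltrD2l.
have [[k ka] [l lb]] := (bnd a, bnd b).
have [|r [r0 rA rB] re] := inf_lt _ AB; last by exists r.
exists (Num.max 1 (Num.max k%:R l%:R)); split.
- by rewrite lt_max ltr01.
- move=> x _; exists b; rewrite //= ballEmdist /=.
  by rewrite !lt_max lb !orbT.
- move=> x _; exists a; rewrite //= ballEmdist /=.
  by rewrite !lt_max ka !orbT.
Qed.

End Metric.

(** * Consequences of ball growth *)

Section CompactDynamics.
Context {R : realType} {X : metricType R}.
Implicit Types (f : homeomorphism X) (m n : int) (x y p : X).
Context (X_compact : compact [set: X]).

(** Only pairs of the form [x |` B], [B] matter: for general [A] and [B] a
    point [x] of [A] missing from [B] is compared with [B] alone, and the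
    largest [B] at distance [r] from [x] is the complement of a ball. *)
Lemma hyper_expansive_growth f :
  hyper_expansive f <-> exists2 dl : R, 0 < dl & forall x, ball_growth f dl x.
Proof.
split=> [[dl dl0 H]|[dl dl0 G]].
  exists (dl / 2) => [|x r r0]; first by rewrite divr_gt0.
  apply: contrapT => /forallNP noN.
  have {}noN n : exists2 y, r <= mdist x y &
      mdist (iterz f n x) (iterz f n y) < dl / 2.
    have /existsNP[y /not_implyP[ny /negP]] := noN n.
    by rewrite -leNgt; exists y.
  pose B := [set y | r <= mdist x y].
  have B_compact : compact B.
    by apply: subclosed_compact X_compact _ => //; exact: closed_far.
  have xB : ~ B x by rewrite /B /= mdistxx leNgt r0.
  apply: xB; rewrite -(H (x |` B) B) //; first by left.
  - split; first by exists x; left.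
    by apply: compactU => //; exact: compact_set1.
  - by split=> //; have [y] := noN 0; exists y.
  move=> n; apply: (@le_lt_trans _ _ (dl / 2)); last by lra.
  apply: hausdorff_dist_le; first by rewrite divr_gt0.
  - have [y yB ny] := noN n.
    move=> _ [z [->|zB] <-].
      by exists (iterz f n y); [exists y|rewrite ballEmdist /= metric_sym].
    exists (iterz f n z); first by exists z.
    by rewrite ballEmdist /= mdistxx divr_gt0.
  - move=> _ [z zB <-]; exists (iterz f n z); first by exists z => //; right.
    by rewrite ballEmdist /= mdistxx divr_gt0.
exists dl => // A B hA hB AB.
have key (A' B' : set X) : A' !=set0 -> hyperspace B' ->
    (forall n, hausdorff_dist (iterz f n @` A') (iterz f n @` B') < dl) ->
    A' `<=` B'.
  move=> A'0 [B'0 B'c] A'B' x A'x; apply: contrapT => nB'x.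
  have : nbhs x (~` B').
    apply: open_nbhs_nbhs; split=> //; apply: closed_openC.
    by apply: compact_closed => //; exact: metric_hausdorff.
  move=> /nbhs_distP[r r0 rB'].
  have [n nP] := G x r r0.
  have [||s sdl [sA' _]] := hausdorff_dist_lt _ _ X_compact (A'B' n).
  - by have [a ?] := A'0; exists (iterz f n a); exists a.
  - by have [b ?] := B'0; exists (iterz f n b); exists b.
  have [_ [b B'b <-]] := sA' (iterz f n x) (ex_intro2 _ _ x A'x erefl).
  rewrite ballEmdist /= metric_sym => /lt_trans/(_ sdl)/nP/rB'.
  exact.
apply/seteqP; split; apply: key => //; [by case: hA|by case: hB|].
move=> n; have -> // : hausdorff_dist (iterz f n @` B) (iterz f n @` A) =
  hausdorff_dist (iterz f n @` A) (iterz f n @` B).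
by congr inf; apply/seteqP; split=> e [].
Qed.

Definition invariant_set f (Y : set X) := forall n x, Y x -> Y (iterz f n x).

Lemma invariant_closure_orbitz f x : invariant_set f (closure (orbitz f x)).
Proof.
move=> n y xy A /iterz_continuous /xy [_ [[m _ <-] Am]].
by exists (iterz f (n + m) x); split; [exists (n + m)|rewrite iterzD].
Qed.

(** A trace [V c] that is minimal for [le] is a single point: if it contained
    [x <> y], some [f^m] would map it into itself near [x] and some [f^n]
    into itself near [y], and [f^m (f^n x) = f^n (f^m x)] would be close to
    both. *)
Lemma isolated_point_of_growth f (dl : R) (Y : set X) : 0 < dl ->
  (forall x, ball_growth f dl x) -> invariant_set f Y -> Y !=set0 ->
  exists2 x, Y x &
    exists2 r, 0 < r & forall y, Y y -> mdist x y < r -> y = x.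
Proof.
move=> dl0 G Yinv [x0 Yx0].
have dl20 : 0 < dl / 2 by rewrite divr_gt0.
have [s sP] := compact_net X_compact dl20.
pose V c := [set y | Y y /\ mdist c y < dl / 2].
pose le c c' := exists n, forall y, V c y -> V c' (iterz f n y).
have absorb x r : Y x -> 0 < r -> exists2 c, c \in s & V c !=set0 /\
    exists n, forall y, V c y -> mdist x (iterz f n y) < r.
  move=> Yx r0; have [n nP] := G x r r0.
  have [c cs cx] := sP (iterz f n x).
  exists c => //; split; first by exists (iterz f n x); split=> //; exact: Yinv.
  exists (- n) => y [Yy cy]; apply: nP; rewrite iterzNK.
  apply: le_lt_trans (metric_triangle _ c _) _.
  by rewrite (metric_sym _ c); lra.
have [|||c [cs [x [Yx cx]] cmin]] :=
  @finite_preorder_min _ le (fun c => V c !=set0) s.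
- by move=> c; exists 0.
- move=> b a c [m mP] [n nP]; exists (n + m) => y /mP/nP.
  by rewrite iterzD.
- have [c cs [c0 _]] := absorb x0 1 Yx0 ltr01; by exists c.
exists x => //.
(* Minimality turns an iterate of [V b] into an iterate of [V c] itself. *)
have self_absorb z r : V c z -> 0 < r -> exists n, forall y, V c y ->
    V c (iterz f n y) /\ mdist z (iterz f n y) < r.
  move=> [Yz cz] r0; set r' := Num.min r (dl / 2 - mdist c z).
  have r'0 : 0 < r' by rewrite lt_min r0 subr_gt0.
  have [b bs [b0 [n nP]]] := absorb z r' Yz r'0.
  have in_c y : V b y -> V c (iterz f n y) /\ mdist z (iterz f n y) < r.
    move=> Vy; have := nP y Vy; rewrite lt_min => /andP[-> zy].
    split=> //; split; first by apply: Yinv; case: Vy.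
    by apply: le_lt_trans (metric_triangle c z _) _; rewrite -ltrBrDl.
  have [|m mP] := cmin b bs b0; first by exists n => y /in_c[].
  by exists (n + m) => y /mP/in_c; rewrite iterzD.
exists (dl / 2 - mdist c x) => [|y Yy xy]; first by rewrite subr_gt0.
apply: contrapT => yx.
have Vx : V c x by [].
have Vy : V c y.
  split=> //; apply: le_lt_trans (metric_triangle c x y) _.
  by rewrite -ltrBrDl.
have r0 : 0 < mdist x y / 2.
  by rewrite divr_gt0 // mdist_gt0; apply/eqP => /esym.
have [m mP] := self_absorb x _ Vx r0.
have [n nP] := self_absorb y _ Vy r0.
have [_ d1] := mP _ (nP x Vx).1.
have [_ d2] := nP _ (mP x Vx).1.
rewrite -iterzD addrC iterzD in d1.
have := metric_triangle x (iterz f n (iterz f m x)) y.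
rewrite (metric_sym (iterz f n _) y) leNgt => /negP; apply; lra.
Qed.

(** The isolated point [y] of the orbit closure is approached by the orbit,
    so it is some [f^n x], and [f^n] is a homeomorphism of the closure. *)
Lemma isolated_in_orbit_closure f (dl : R) x : 0 < dl ->
  (forall x, ball_growth f dl x) ->
  exists2 r, 0 < r &
    forall y, closure (orbitz f x) y -> mdist x y < r -> y = x.
Proof.
move=> dl0 G.
have x_in : orbitz f x x by exists 0.
have [|y xy [r r0 rP]] := isolated_point_of_growth dl0 G
  (@invariant_closure_orbitz f x).
  by exists x; exact: subset_closure.
have [|_ [[n _ <-] /= yn]] := xy [set z | mdist y z < r].
  by apply/nbhs_distP; exists r.
have ny : iterz f n x = y.
  by apply: rP => //; apply: subset_closure; exists n.
have [a a0 aP] := iterz_near f n x r0.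
exists a => // z xz /aP; rewrite ny => /rP nz.
rewrite -[LHS](iterzK f n) nz -?ny ?iterzK //.
exact: invariant_closure_orbitz.
Qed.

(** The balls of a finite cover that an orbit meets determine its closure:
    a ball around a point [u] outside the closure of the orbit of [v] grows
    to contain, at some time [n], the ball of the cover holding [f^n u], which
    the orbit of [v] then avoids. As each point is isolated in its orbit
    closure, two orbits with the same closure coincide. *)
Lemma finitely_many_orbits_of_growth f (dl : R) : 0 < dl ->
  (forall x, ball_growth f dl x) -> finitely_many_orbits f.
Proof.
move=> dl0 G; have dl20 : 0 < dl / 2 by rewrite divr_gt0.
have [s sP] := compact_net X_compact dl20.
pose near c x n := mdist c (iterz f n x) < dl / 2.
pose code x : {ffun seq_sub s -> bool} :=
  [ffun c => `[< exists n, near (val c) x n >]].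
apply: (finite_image_factor (g := code)) => x y xy.
have sub u v : code u = code v -> closure (orbitz f v) u.
  move=> uv A /nbhs_distP[r r0 rA]; have [n nP] := G u r r0.
  have [c cs cu] := sP (iterz f n u).
  have : code u (SeqSub cs) by rewrite ffunE; apply/asboolP; exists n.
  rewrite uv ffunE => /asboolP[m /= cv].
  exists (iterz f (m - n) v); split; first by exists (m - n).
  apply/rA/nP; rewrite -iterzD addrC subrK.
  apply: le_lt_trans (metric_triangle _ c _) _.
  by rewrite (metric_sym _ c); rewrite /near in cv; lra.
have [r r0 rP] := isolated_in_orbit_closure x dl0 G.
have [|_ [[n _ <-] /= xn]] := sub x y xy [set z | mdist x z < r].
  by apply/nbhs_distP; exists r.
rewrite -(rP (iterz f n y)) ?orbitz_iter //.
by apply: invariant_closure_orbitz; exact: sub.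
Qed.

(** A ball around [x] containing no other point of the orbit can grow only at
    a [lonely] time [n], and a finite net allows finitely many of these. If [x]
    were not isolated, each lonely [n] would come with some [w <> x] whose
    [n]-th iterate is within [dl] of [f^n x], and a ball around [x] avoiding
    these finitely many [w] could not grow at a lonely time either. *)
Lemma aperiodic_isolated_of_growth f (dl : R) x : 0 < dl ->
  (forall x, ball_growth f dl x) -> ~ Defs.periodic f x ->
  exists2 r, 0 < r & forall y, mdist x y < r -> y = x.
Proof.
move=> dl0 G npx; apply: contrapT => nisol.
have dl20 : 0 < dl / 2 by rewrite divr_gt0.
have [s sP] := compact_net X_compact dl20.
have [a a0 aP] := isolated_in_orbit_closure x dl0 G.
pose lonely := [set n | forall m,
  mdist (iterz f n x) (iterz f m x) < dl -> m = n].
(* Two lonely times cannot share a point of the net. *)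
have lonely_fin : finite_set lonely.
  have /choice[g gP] n : exists c, c \in s /\ mdist c (iterz f n x) < dl / 2.
    by have [c ? ?] := sP (iterz f n x); exists c.
  have : finite_set (g @` lonely).
    apply: sub_finite_set (finite_seq s) => _ [n _ <-] /=.
    by have [] := gP n.
  rewrite (eq_finite_set (inj_card_eq _)) // => m n.
  rewrite !inE => lm ln mn; apply: ln.
  apply: le_lt_trans (metric_triangle _ (g n) _) _.
  have := (gP n).2; have := (gP m).2.
  by rewrite mn (metric_sym _ (g n)); lra.
have [||r r0 rP] := @finite_uniform_radius R int lonely
  (fun n r => exists2 w, r <= mdist x w &
     mdist (iterz f n x) (iterz f n w) < dl)
  lonely_fin.
- by move=> n b c cb [w bw ?]; exists w => //; exact: le_trans bw.
- move=> n _; have [b b0 bP] := iterz_near f n x dl0.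
  have /existsNP[w /not_implyP[xw wx]] : ~ forall y, mdist x y < b -> y = x.
    by move=> bx; apply: nisol; exists b.
  exists (mdist x w); first by rewrite mdist_gt0; apply/eqP => /esym.
  by exists w => //; exact: bP.
have [|n nP] := G x (Num.min r a); first by rewrite lt_min r0.
have [/rP[w rw /nP]|] := pselect (lonely n).
  by rewrite lt_min ltNge rw.
move=> /existsNP[m /not_implyP[nm mn]]; apply: mn.
have mE : iterz f m x = iterz f n (iterz f (m - n) x).
  by rewrite -iterzD addrC subrK.
move: nm; rewrite mE => /nP; rewrite lt_min => /andP[_ xm].
apply/eqP; rewrite -subr_eq0; apply/eqP/(iterz_aperiodic npx).
by apply: aP => //; apply: subset_closure; exists (m - n).
Qed.

End CompactDynamics.

(** * Stability and wandering points *)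

Section Stability.
Context {R : realType} {X : metricType R}.
Implicit Types (f : homeomorphism X) (m n : int) (x y p : X).
Context (X_compact : compact [set: X]).

(** If no point other than [p] has a past that stays within [e] of the past
    of [p], then by compactness a point which has done so for [m] steps is
    already close to [p], for [m] large. It is applied to [f^(q * l) x], with
    [q * l] the last multiple of the period before time [k]: there the orbit
    of [p] is back at [p]. *)
Lemma forward_companions_converge f p (q : nat) (e h : R) :
  (0 < q)%N -> iter q f p = p -> 0 < h ->
  (forall w, (forall i : nat,
     mdist (iterz f (- i%:Z) w) (iterz f (- i%:Z) p) <= e) -> w = p) ->
  exists M : nat, forall x (k : nat), (M <= k)%N ->
    (forall i, (i < k)%N -> mdist (iter i f x) (iter i f p) <= e) ->
    mdist (iter k f x) (iter k f p) < h.
Proof.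
move=> q0 qp h0 triv.
have [||r r0 rP] := @finite_uniform_radius R nat `I_q.+1
  (fun j r => forall w, mdist p w < r ->
     mdist (iterz f j p) (iterz f j w) < h) (finite_II _).
- by move=> j a b ba aP w wb; apply/aP/(lt_le_trans wb).
- by move=> j _; exact: iterz_near.
pose U k w := mdist p w < r \/ exists2 i : nat, (i <= k)%N &
  e < mdist (iterz f (- i%:Z) w) (iterz f (- i%:Z) p).
have [||m mU] := @compact_increasing_cover _ _ U X_compact.
- move=> k l kl w [pw|[i ik ?]]; [by left|right].
  by exists i => //; exact: leq_trans kl.
- move=> w; have [->|wp] := pselect (w = p).
    by exists 0%N, r => // y; left.
  have /existsNP[i /negP] : ~ forall i : nat,
      mdist (iterz f (- i%:Z) w) (iterz f (- i%:Z) p) <= e.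
    by move/triv.
  rewrite -ltNge -subr_gt0 => ei.
  have [a a0 aP] := iterz_near f (- i%:Z) w ei.
  exists i, a => // y /aP wy; right; exists i => //.
  have := metric_triangle (iterz f (- i%:Z) w) (iterz f (- i%:Z) y)
    (iterz f (- i%:Z) p).
  by lra.
exists (q * m).+1 => x k Mk xp.
pose l := (k.-1 %/ q)%N.
have ml : (m <= l)%N by rewrite leq_divRL // mulnC; lia.
have lk : (q * l < k)%N by have := leq_trunc_div k.-1 q; rewrite mulnC; lia.
have kl : (k - q * l <= q)%N.
  by have := divn_eq k.-1 q; have := ltn_pmod k.-1 q0; rewrite -/l mulnC; lia.
have lp := iterz_period l qp.
have kE y : iter k f y = iterz f (k - q * l)%N (iterz f (q * l)%N y).
  by rewrite -iterzD -PoszD subnK // ltnW.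
have [pw|[i im]] := mU (iterz f (q * l)%N x).
  by rewrite !kE lp metric_sym; apply: rP.
rewrite -{1}lp -!iterzD.
have il : (i <= q * l)%N by nia.
have -> : - i%:Z + (q * l)%N = (q * l - i)%N by lia.
by rewrite ltNge => /negP[]; apply: (xp (q * l - i)%N); lia.
Qed.

(** Continuity keeps the orbits of nearby points within [a] of that of [p] up
    to time [M]; from then on, staying within [a <= e] until time [k] forces
    distance less than [a] at time [k] as well. *)
Lemma asymptotically_stable_of_trivial_past f p (e : R) :
  0 < e -> Defs.periodic f p ->
  (forall w, (forall i : nat,
     mdist (iterz f (- i%:Z) w) (iterz f (- i%:Z) p) <= e) -> w = p) ->
  asymptotically_stable f p.
Proof.
move=> e0 [q q0 qp] triv.
have st : forall a : R, 0 < a -> a <= e -> exists2 d : R, 0 < d &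
    forall x, mdist x p < d ->
    forall k : nat, mdist (iter k f x) (iter k f p) < a.
  move=> a a0 ae.
  have [M MP] := forward_companions_converge q0 qp a0 triv.
  have [||r r0 rP] := @finite_uniform_radius R nat `I_M
    (fun j r => forall w, mdist p w < r ->
       mdist (iterz f j p) (iterz f j w) < a) (finite_II _).
  - by move=> j b c cb bP w wc; apply/bP/(lt_le_trans wc).
  - by move=> j _; exact: iterz_near.
  exists r => // x xp k; elim/ltn_ind: k => k IH.
  have [Mk|kM] := leqP M k.
    by apply: MP => // i /IH/ltW/le_trans; exact.
  by rewrite metric_sym; apply: rP => //; rewrite metric_sym.
split.
  move=> a a0; have [||d d0 dP] := st (Num.min a e).
  - by rewrite lt_min a0.
  - by rewrite ge_min lexx orbT.
  by exists d => // x /dP xp k; have := xp k; rewrite lt_min => /andP[].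
have [d d0 dP] := st e e0 (lexx e).
exists d => // x /dP xp; apply/cvgr0Pnorm_lt => h h0.
have [M MP] := forward_companions_converge q0 qp h0 triv.
exists M => // k /= Mk; rewrite ger0_norm ?mdist_ge0 //.
by apply: MP => // i _; exact: ltW.
Qed.

(** If both the past and the future of [p] were shadowed, by [z] and [w], then
    a ball around [p] excluding [z] and [w] could not grow at a time [n >= 0]
    because of [w], nor at a time [n < 0] because of [z]. *)
Lemma periodic_attracting_or_repelling f (dl : R) p :
  0 < dl -> ball_growth f dl p ->
  Defs.periodic f p -> (Per_r f `|` Per_a f) p.
Proof.
move=> dl0 G per_p; have dl20 : 0 < dl / 2 by rewrite divr_gt0.
have dl2 : dl / 2 < dl by lra.
have [past|npast] := pselect (forall w, (forall i : nat,
     mdist (iterz f (- i%:Z) w) (iterz f (- i%:Z) p) <= dl / 2) -> w = p).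
  by right; split=> //; exact: asymptotically_stable_of_trivial_past past.
left; split=> //.
apply: (@asymptotically_stable_of_trivial_past (inverse_homeo f) _ (dl / 2))
  => //.
  exact/periodic_inverse.
move=> w wP; apply: contrapT => wp; apply: npast => z zP.
apply: contrapT => zp.
have [|n nP] := G (Num.min (mdist p w) (mdist p z)).
  by rewrite lt_min !mdist_gt0; apply/andP; split; apply/eqP => /esym.
have [n0|n0] := leP 0 n.
  suff /nP : mdist (iterz f n p) (iterz f n w) < dl by rewrite lt_min ltxx.
  have := wP `|n|%N; rewrite !iterz_inverse opprK gez0_abs //.
  by rewrite metric_sym => /le_lt_trans; apply; lra.
suff /nP : mdist (iterz f n p) (iterz f n z) < dl.
  by rewrite lt_min ltxx andbF.
have := zP `|n|%N; rewrite ltz0_abs // opprK.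
by rewrite metric_sym => /le_lt_trans; apply; lra.
Qed.

Lemma periodic_nonwandering f p : Defs.periodic f p -> nonwandering f p.
Proof.
move=> [q q0 qp] e e0; exists q => //; exists p.
have pe : ball p e p by rewrite ballEmdist /= mdistxx.
by split=> //; exists p.
Qed.

Lemma isolated_nonwandering_periodic f x (r : R) : 0 < r ->
  (forall y, mdist x y < r -> y = x) -> nonwandering f x ->
  Defs.periodic f x.
Proof.
move=> r0 rP /(_ r r0)[q q0 [_ [[y + <-] +]]]; rewrite !ballEmdist /= => /rP ->.
by move=> /rP qx; exists q.
Qed.

(** A ball that never returns to itself contains at most one point of each
    orbit, so it is finite. *)
Lemma wandering_isolated f x : finitely_many_orbits f -> ~ nonwandering f x ->
  exists2 r, 0 < r & forall y, mdist x y < r -> y = x.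
Proof.
move=> orbits_fin /existsNP[e /not_implyP[e0 noret]].
have once y z : ball x e y -> ball x e z -> orbitz f y = orbitz f z -> y = z.
  have pos (k : nat) u : ball x e u -> ball x e (iterz f k u) ->
      iterz f k u = u.
    case: k => // k xu xku; case: noret; exists k.+1 => //.
    by exists (iterz f k.+1 u); split=> //; exists u.
  move=> xy xz yz.
  have [n _ yE] : orbitz f z y by rewrite -yz; exists 0.
  rewrite -yE; rewrite -yE in xy; clear yE yz.
  case: n xy => k xy; first exact: pos.
  have zE : iterz f k.+1 (iterz f (Negz k) z) = z by rewrite -iterzD addrN.
  by rewrite -[RHS]zE pos // zE.
have ball_fin : finite_set (ball x e).
  rewrite -(eq_finite_set (inj_card_eq (f := orbitz f) _)).
    by apply: sub_finite_set orbits_fin => _ [y _ <-]; exists y.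
  by move=> y z /set_mem xy /set_mem xz; exact: once.
have [||r r0 rP] := @finite_uniform_radius R X (ball x e)
  (fun y r => y != x -> r <= mdist x y) ball_fin.
- by move=> y a b ba aP /aP; exact: le_trans.
- move=> y _; have [->|yx] := eqVneq y x; first by exists 1.
  by exists (mdist x y) => //; rewrite mdist_gt0 eq_sym.
exists (Num.min r e); first by rewrite lt_min r0.
move=> y; rewrite lt_min => /andP[xr xe]; apply/eqP; apply: contraTT xr => yx.
by rewrite -leNgt rP // ballEmdist.
Qed.

Lemma isolated_growth f x (r : R) :
  (forall y, mdist x y < r -> y = x) -> ball_growth f r x.
Proof. by move=> rP e e0; exists 0 => y /(rP y) ->; rewrite mdistxx. Qed.

(** Stability makes entering the ball of radius [d] irrevocable, so that the
    pointwise attraction on the closed ball of radius [g / 2] happens, by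
    compactness, within a common time [q * m]. Balls of radius [r] have
    therefore grown to radius [g / 2] after [q * m] backward steps. *)
Lemma attracting_growth f p : Per_a f p ->
  exists2 dl : R, 0 < dl & ball_growth f dl p.
Proof.
move=> [[q q0 qp] [st [g g0 gP]]].
exists (g / 2) => [|r r0]; first by rewrite divr_gt0.
have [d d0 dP] := st r r0.
pose U k x := g / 2 < mdist p x \/ exists2 i : nat, (i <= k)%N &
  mdist p (iterz f (q * i)%N x) < d.
have [||m mU] := @compact_increasing_cover _ _ U X_compact.
- move=> k l kl w [pw|[i ik ?]]; [by left|right].
  by exists i => //; exact: leq_trans kl.
- move=> x; have [gx|xg] := ltP (g / 2) (mdist p x).
    exists 0%N, (mdist p x - g / 2) => [|y xy]; first by rewrite subr_gt0.
    left; have := metric_triangle p y x; rewrite (metric_sym y x); lra.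
  have /gP/cvgr0Pnorm_lt/(_ d d0)[M _ MP] : mdist x p < g.
    by rewrite metric_sym; lra.
  have := MP (q * M)%N; rewrite /= leq_pmull // => /(_ isT).
  rewrite ger0_norm ?mdist_ge0 // -[iter _ f p]/(iterz f (q * M)%N p).
  rewrite iterz_period // metric_sym -subr_gt0 => xM.
  have [a a0 aP] := iterz_near f (q * M)%N x xM.
  exists M, a => // y /aP xy; right; exists M => //.
  have := metric_triangle p (iterz f (q * M)%N x) (iterz f (q * M)%N y).
  by move: xy; rewrite /=; lra.
exists (- (q * m)%N%:Z) => y; rewrite iterzN_period // => pz.
have [|[i im]] := mU (iterz f (- (q * m)%N%:Z) y).
  by rewrite ltNge (ltW pz).
set z := iterz f _ (iterz f _ y) => zd.
have zE : iterz f (q * (m - i))%N z = y.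
  have qmi : (q * (m - i) + q * i = q * m)%N by nia.
  by rewrite /z -iterzD -PoszD qmi iterzNK.
rewrite -zE metric_sym -(iterz_period (m - i) qp).
by apply: dP; rewrite metric_sym.
Qed.

Lemma uniform_growth_of_finitely_many_orbits f : finitely_many_orbits f ->
  nonwandering f = Per_r f `|` Per_a f ->
  exists2 dl : R, 0 < dl & forall x, ball_growth f dl x.
Proof.
move=> orbits_fin NW.
have loc x : exists2 dl : R, 0 < dl & ball_growth f dl x.
  have [|nwx] := pselect (nonwandering f x).
    rewrite NW => -[[per_x st]|/attracting_growth //].
    have [|dl dl0 G] := @attracting_growth (inverse_homeo f) x.
      by split=> //; exact/periodic_inverse.
    by exists dl => //; exact: ball_growth_inverse.
  have [r r0 rP] := wandering_isolated orbits_fin nwx.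
  by exists r => //; exact: isolated_growth.
have [||dl dl0 dlP] := @finite_uniform_radius R _ _
  (fun O r => forall x, O = orbitz f x -> ball_growth f r x) orbits_fin.
- by move=> O a b ba aP x /aP; exact: ball_growthS.
- move=> _ [x _ <-]; have [dl dl0 G] := loc x; exists dl => // y xy.
  have [n _ <-] : orbitz f x y by rewrite xy; exists 0.
  exact: ball_growth_iter.
by exists dl => // x; apply: dlP; [exists x|].
Qed.

End Stability.

Theorem theorem2p2 (R : realType) (X : metricType R)
    (X_compact : compact [set: X]) (f : homeomorphism X) :
  hyper_expansive f <->
  (finitely_many_orbits f /\ nonwandering f = Per_r f `|` Per_a f).
Proof.
split=> [/(hyper_expansive_growth X_compact)[dl dl0 G]|[orbits_fin NW]].
  split; first exact: finitely_many_orbits_of_growth G.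
  apply/seteqP; split=> x.
    move=> nwx; apply: (periodic_attracting_or_repelling X_compact dl0 (G x)).
    apply: contrapT => npx.
    have [r r0 rP] := aperiodic_isolated_of_growth X_compact dl0 G npx.
    exact/npx/(isolated_nonwandering_periodic r0 rP).
  by move=> [[]|[]] /periodic_nonwandering.
apply/(hyper_expansive_growth X_compact).
exact: uniform_growth_of_finitely_many_orbits.
Qed.
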